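(* Let $G^+=\langle L\mid R\rangle_{mo}$ be a positively presented atomic cancellative monoid that satisfies the LCM condition and has $\mathcal{F}(G^+)\neq\emptyset$ (i.e. $G^+$ is a Garside monoid). Then the two-sided idealistic subsemigroup $\mathcal{F}(G^+)\subseteq\mathcal{QZ}(G^+)$ is singly generated, i.e. there exists $\widehat\Delta\in\mathcal{F}(G^+)$ such that $\mathcal{F}(G^+)=\mathcal{QZ}(G^+)\,\widehat\Delta\,\mathcal{QZ}(G^+)$.
   Context: $L$ is a finite set, $R$ a finite set of relations $R_i=S_i$ between positive words (words in the free monoid $L^*$), and $G^+=\langle L\mid R\rangle_{mo}$ is the quotient of $L^*$ by the congruence generated by $R$. $G^+$ is atomic if there is a map $\nu:G^+\to\mathbb{Z}_{\ge 0}$ with $\nu(\alpha)=0\iff\alpha=1$ and $\nu(\alpha\beta)\ge\nu(\alpha)+\nu(\beta)$ for all $\alpha,\beta$. It is cancellative if $AXB=AYB$ implies $X=Y$. An atom is an element $\alpha\ne 1$ such that $\alpha=\beta\gamma$ implies $\beta=1$ or $\gamma=1$. A generator $g\in L$ is a dummy generator if $R$ contains a relation $g=w$ with $w$ a positive word in the generators other than $g$; $\widetilde L$ is the set of non-dummy generators. Its image in $G^+$ is the set of all atoms, and $\widetilde L$ is identified with this image. An element $\Delta\in G^+$ is quasi-central if there is a permutation $\sigma$ of $\widetilde L$ with $s\cdot\Delta=\Delta\cdot\sigma(s)$ for all $s\in\widetilde L$; $\mathcal{QZ}(G^+)$ is the set of quasi-central elements (it contains $1$). A fundamental element is an element $\Delta\in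 G^+$ for which there is a permutation $\sigma$ of $\widetilde L$ such that for every $s\in\widetilde L$ there is $\Delta_s\in G^+$ with $\Delta=s\cdot\Delta_s=\Delta_s\cdot\sigma(s)$; $\mathcal{F}(G^+)$ is the set of fundamental elements ($1\notin\mathcal{F}(G^+)$). One has $\mathcal{F}(G^+)\mathcal{QZ}(G^+)=\mathcal{QZ}(G^+)\mathcal{F}(G^+)=\mathcal{F}(G^+)$. $U$ divides $V$ from the left (right) if $V=UW$ (resp. $V=WU$) for some $W\in G^+$. The LCM condition: any two elements $U,V$ have a right least common multiple (an element left-divisible by $U$ and $V$ which divides from the left every element left-divisible by both) and a left least common multiple (defined symmetrically). *)

(* Defs.v *)
From HB Require Import structures.
From mathcomp Require Import all_boot.
From mathcomp Require Import boolp classical_sets functions.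

Set Implicit Arguments.
Unset Strict Implicit.
Unset Printing Implicit Defensive.

Local Open Scope group_scope.
Local Open Scope classical_set_scope.
Local Open Scope quotient_scope.

(* A positive presentation is a finType [L] with a list [R] of pairs of words,
   the pair [(u, v)] standing for the relation u = v. *)
Section Presentation.
Variables (L : finType) (R : seq (seq L * seq L)).

Inductive wcong : seq L -> seq L -> Prop :=
| wcong_rel u v : (u, v) \in R -> wcong u v
| wcong_refl u : wcong u u
| wcong_sym u v : wcong u v -> wcong v u
| wcong_trans v u w : wcong u v -> wcong v w -> wcong u w
| wcong_cat u u' v v' : wcong u u' -> wcong v v' ->
    wcong (u ++ v) (u' ++ v').

Definition wcongb : rel (seq L) := fun u v => `[< wcong u v >].

Lemma wcongb_refl : reflexive wcongb.
Proof. by move=> u; apply/asboolP; exact: wcong_refl. Qed.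

Lemma wcongb_sym : symmetric wcongb.
Proof. by move=> u v; apply/asboolP/asboolP; exact: wcong_sym. Qed.

Lemma wcongb_trans : transitive wcongb.
Proof.
move=> v u w /asboolP uv /asboolP vw; apply/asboolP.
exact: wcong_trans uv vw.
Qed.

Canonical wcong_equiv := EquivRel wcongb wcongb_refl wcongb_sym wcongb_trans.

Definition pmonoid := {eq_quot wcong_equiv}.

HB.instance Definition _ := Choice.on pmonoid.
HB.instance Definition _ := EqQuotient.on pmonoid.

Definition pword (w : seq L) : pmonoid := \pi w.

Lemma pwordP u v : pword u = pword v <-> wcong u v.
Proof.
split; first by move=> /eqmodP /asboolP.
by move=> uv; apply/eqmodP/asboolP.
Qed.

Lemma pword_repr (x : pmonoid) : pword (repr x) = x.
Proof. exact: reprK. Qed.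

Definition pmul (x y : pmonoid) : pmonoid := pword (repr x ++ repr y).

Lemma pmul_pword u v : pmul (pword u) (pword v) = pword (u ++ v).
Proof.
by apply/pwordP/wcong_cat; apply/pwordP; rewrite pword_repr.
Qed.

Lemma pmulA : associative pmul.
Proof.
move=> x y z; rewrite -(pword_repr x) -(pword_repr y) -(pword_repr z).
by rewrite !pmul_pword catA.
Qed.

Lemma pmul1g : left_id (pword [::]) pmul.
Proof. by move=> x; rewrite -(pword_repr x) pmul_pword. Qed.

Lemma pmulg1 : right_id (pword [::]) pmul.
Proof. by move=> x; rewrite -(pword_repr x) pmul_pword cats0. Qed.

HB.instance Definition _ := isMonoid.Build pmonoid pmulA pmul1g pmulg1.

Definition dummy (g : L) : Prop :=
  exists w : seq L,
    g \notin w /\ (([:: g], w) \in R \/ (w, [:: g]) \in R).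

Definition nondummy : set L := [set g | ~ dummy g].

End Presentation.

Section Monoids.
Variable M : monoidType.

Definition atomic : Prop :=
  exists nu : M -> nat,
    (forall x, nu x = 0%N <-> x = 1) /\
    (forall x y, (nu x + nu y <= nu (x * y)%g)%N).

Definition cancellative : Prop :=
  forall a b x y : M, a * x * b = a * y * b -> x = y.

Definition atoms : set M :=
  [set x | x <> 1 /\ forall y z, x = y * z -> y = 1 \/ z = 1].

Definition ldivides (u v : M) : Prop := exists w, v = u * w.
Definition rdivides (u v : M) : Prop := exists w, v = w * u.

Definition is_right_lcm (u v m : M) : Prop :=
  [/\ ldivides u m, ldivides v m &
      forall n, ldivides u n -> ldivides v n -> ldivides m n].

Definition is_left_lcm (u v m : M) : Prop :=
  [/\ rdivides u m, rdivides v m &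
      forall n, rdivides u n -> rdivides v n -> rdivides m n].

Definition lcm_condition : Prop :=
  forall u v : M, (exists m, is_right_lcm u v m) /\ (exists m, is_left_lcm u v m).

(* The non-dummy generators are identified with their images, which are the
   atoms (see [nondummy_atoms] below).  A permutation of the atoms is a function
   [s : M -> M] restricting to a bijection of [atoms]; its values elsewhere are
   irrelevant. *)
Definition quasi_central : set M :=
  [set D | exists s : M -> M, set_bij atoms atoms s /\
     forall a, atoms a -> a * D = D * s a].

Definition fundamental : set M :=
  [set D | exists s : M -> M, set_bij atoms atoms s /\
     forall a, atoms a -> exists Da, D = a * Da /\ D = Da * s a].

End Monoids.

Arguments atomic : clear implicits.
Arguments cancellative : clear implicits.
Arguments atoms : clear implicits.
Arguments lcm_condition : clear implicits.
Arguments quasi_central : clear implicits.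
Arguments fundamental : clear implicits.

(* The conditions on [R] cannot be dropped: with the relation a = b both
   generators are dummy, and with the relations t = 1, tc = ab the generator c
   is not dummy although its image is not an atom. *)
Section NonDummy.
Variables (L : finType) (R : seq (seq L * seq L)).
Hypothesis R_nonempty : forall u v, (u, v) \in R -> u != [::] /\ v != [::].
Hypothesis R_norename : forall g h, ([:: g], [:: h]) \notin R.
Hypothesis atomicR : atomic (pmonoid R).

Lemma pwordM u v : pword R (u ++ v) = pword R u * pword R v.
Proof. by rewrite -pmul_pword. Qed.

Lemma wcong_nil u v : wcong R u v -> (u == [::]) = (v == [::]).
Proof.
elim=> {u v} [u v /R_nonempty [/negPf-> /negPf->]|//|u v _ ->//|
  v u w _ -> _ ->//|u u' v v' _ + _ +] //.
by case: u u' => [|? ?] [|? ?].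
Qed.

Lemma pword_eq1 u : pword R u = 1 -> u = [::].
Proof.
by move=> /(pwordP R u [::]) /wcong_nil; rewrite eqxx => /eqP.
Qed.

Lemma nondummy_rel g u v : nondummy R g -> (u, v) \in R \/ (v, u) \in R ->
  u = [:: g] -> v = [:: g].
Proof.
move=> ndg uvR ug; subst u.
have gv : g \in v.
  by apply/negPn/negP => gv; apply: ndg; exists v.
have : pword R [:: g] = pword R v.
  apply/pwordP; case: uvR => uvR; first exact: wcong_rel.
  exact/wcong_sym/wcong_rel.
have [nu [nu1 nuM]] := atomicR.
case/splitPr: gv => v1 v2 E.
have := nuM (pword R v1) (pword R [:: g] * pword R v2).
have := nuM (pword R [:: g]) (pword R v2).
rewrite -!pwordM /= -E => h1 h2.
have /eqP : (nu (pword R v1) + nu (pword R v2) = 0)%N.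
  apply/eqP; rewrite -leqn0 -(leq_add2l (nu (pword R [:: g]))) addn0.
  by apply: leq_trans h2; rewrite addnCA leq_add2l.
rewrite addn_eq0 => /andP[/eqP/nu1/pword_eq1-> /eqP/nu1/pword_eq1->].
by [].
Qed.

Lemma wcong_nondummy g u v : nondummy R g -> wcong R u v ->
  (u == [:: g]) = (v == [:: g]).
Proof.
move=> ndg; elim=> {u v} [u v uvR|//|u v _ ->//|v u w _ -> _ ->//|
  u u' v v' uu' + vv' +].
  by apply/eqP/eqP; apply: nondummy_rel => //; [left|right].
have := wcong_nil uu'; have := wcong_nil vv'.
case: u u' {uu'} => [|x u] [|x' u'] //=.
case: v v' {vv'} => [|y v] [|y' v'] //=; rewrite ?cats0 //.
move=> _ _ _ _; rewrite !eqseq_cons.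
by rewrite -!size_eq0 !size_cat /= !addnS !andbF.
Qed.

Lemma nondummy_inj : {in nondummy R &, injective (fun g => pword R [:: g])}.
Proof.
move=> g h /set_mem ndg _ /pwordP /(wcong_nondummy ndg).
by rewrite eqxx => /esym/eqP[].
Qed.

Lemma nondummy_atoms :
  [set pword R [:: g] | g in nondummy R] = atoms (pmonoid R).
Proof.
apply/seteqP; split=> [_ [g ndg <-]|x [x1 xat]].
  split=> [/pword_eq1//|y z].
  rewrite -(pword_repr y) -(pword_repr z) -pwordM => /pwordP.
  move=> /(wcong_nondummy ndg); rewrite eqxx.
  case: (repr y) => [|a [|b s]]; first by left.
    by case: (repr z) => [|? ?]; [right|rewrite eqseq_cons andbF].
  by rewrite eqseq_cons andbF.
have letter (y : L) (w : seq L) : atoms (pmonoid R) (pword R (y :: w)) ->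
    w = [::].
  move=> [_ /(_ (pword R [:: y]) (pword R w))]; rewrite -pwordM.
  by case=> // /pword_eq1.
have : atoms (pmonoid R) (pword R (repr x)) by rewrite pword_repr.
case E: (repr x) => [|g w] at1; first by case: at1.
have w0 := letter _ _ at1; subst w.
exists g; last by rewrite -E pword_repr.
move=> [w [gw gwR]].
have gwE : pword R [:: g] = pword R w.
  apply/pwordP; case: gwR => gwR; first exact: wcong_rel.
  exact/wcong_sym/wcong_rel.
case: w gw gwR gwE => [|h w] gw gwR gwE.
  by case: gwR => /R_nonempty [].
have w0 : w = [::] by apply: (letter h); rewrite -gwE.
by subst w; case: gwR; apply/negP; exact: R_norename.
Qed.

End NonDummy.

(* Main.v *)
Require Import Defs.
From mathcomp Require Import all_boot.
From mathcomp Require Import boolp classical_sets functions cardinality.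

Set Implicit Arguments.
Unset Strict Implicit.
Unset Printing Implicit Defensive.

Local Open Scope group_scope.
Local Open Scope classical_set_scope.

(** Write M for the monoid and nu for its norm.  Cancellation and generation by
    atoms turn both notions of the theorem into statements about divisibility:
    D is quasi-central iff MD = DM ([quasi_centralP]), and D is fundamental iff
    moreover every atom divides D from the left ([fundamentalP]).  It follows
    that a fundamental element Gamma dividing all fundamental elements from the
    left is a generator: if E = Gamma w is fundamental, then w is quasi-central
    because E and Gamma are ([normal_quotient]).

    To find Gamma, keep only half of the condition MD = DM and consider the set
    S of all G with MG contained in GM that are left divisible by every atom.
    S contains the fundamental elements and is stable under left gcds
    ([absorbs_left_gcd]), so an element Gamma of S of least norm divides all of
    S ([least_absorbing_full]).  It remains to see that GammaM is contained in
    MGamma.  Fix a fundamental element Delta.  The automorphism tau defined by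
    x Delta = Delta tau(x) preserves S, hence fixes its least element Gamma,
    which means that Gamma and Delta commute
    ([least_absorbing_full_commute]).  Therefore the injective endomorphism phi
    defined by x Gamma = Gamma phi(x) fixes Delta, and so maps the left
    divisors of Delta to left divisors of Delta.  These are finitely many, since
    L is finite and the norm bounds the length of words ([finite_divisors]).
    So phi permutes them; as all atoms are among them, phi is onto
    ([absorbs_left_normal]). *)

(** * Injective self-maps of finite sets *)

(** If y is not a value of f on A, then the iterates of y under f are pairwise
    distinct, which makes A infinite. *)
Lemma finite_inj_surj (T : Type) (A : set T) (f : T -> T) :
  finite_set A -> (forall x, A x -> A (f x)) -> injective f ->
  forall y, A y -> exists2 x, A x & f x = y.
Proof.
move=> finA fA finj y Ay; apply: contrapT => noy.
have iterA k : A (iter k f y) by elim: k => //= k; exact: fA.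
have neq i j : (i < j)%N -> iter i f y <> iter j f y.
  move=> ij E; apply: noy; exists (iter (j - i.+1) f y) => //.
  move: E; rewrite -{1}(subnKC ij) addSnnS iterD iterS.
  by move: (iter (j - _) f y) => z; elim: i {ij} => //= i IH /finj.
have iter_inj : injective (fun k => iter k f y).
  move=> i j /=; case: (ltngtP i j) => // ij E.
    by case: (neq _ _ ij).
  by case: (neq _ _ ij).
apply: infinite_nat.
have : finite_set (range (fun k => iter k f y)).
  by apply: sub_finite_set finA => _ [k _ <-].
by rewrite (eq_finite_set (inj_card_eq (in2W iter_inj))).
Qed.

(** * Cancellative monoids with a norm *)

Section GarsideMonoid.
Variables (M : monoidType) (nu : M -> nat).
Hypothesis nu_eq0 : forall x, nu x = 0%N <-> x = 1.
Hypothesis nuM : forall x y, (nu x + nu y <= nu (x * y))%N.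
Hypothesis cancelM : cancellative M.
Implicit Types x y z u v w D E G : M.

Lemma lcancel a x y : a * x = a * y -> x = y.
Proof. by move=> E; apply: (cancelM (a := a) (b := 1)); rewrite !mulg1. Qed.

Lemma rcancel a x y : x * a = y * a -> x = y.
Proof. by move=> E; apply: (cancelM (a := 1) (b := a)); rewrite !mul1g. Qed.

Lemma lcancel1 a x : a * x = a -> x = 1.
Proof. by rewrite -{2}[a]mulg1 => /lcancel. Qed.

Lemma rcancel1 a x : x * a = a -> x = 1.
Proof. by rewrite -{2}[a]mul1g => /rcancel. Qed.

Lemma nu_gt0 x : x <> 1 -> (0 < nu x)%N.
Proof. by move=> x1; rewrite lt0n; apply/eqP => /nu_eq0. Qed.

Lemma nu_dvd_eq x w : (nu (x * w) <= nu x)%N -> w = 1.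
Proof.
move=> le; apply/nu_eq0/eqP; rewrite -leqn0 -(leq_add2l (nu x)) addn0.
exact: leq_trans (nuM x w) le.
Qed.

Lemma ldivides_anti x y : ldivides x y -> ldivides y x -> x = y.
Proof.
move=> [u ->] [v xE]; suff -> : u = 1 by rewrite mulg1.
apply: (@nu_dvd_eq x); rewrite [in leqRHS]xE.
exact: leq_trans (leq_addr _ _) (nuM _ _).
Qed.

(** A non-atom other than 1 is a product of two elements other than 1, each of
    smaller norm, so atomicity yields generation by the atoms. *)
Lemma atom_ind (P : M -> Prop) : P 1 -> (forall a, atoms M a -> P a) ->
  (forall x y, P x -> P y -> P (x * y)) -> forall x, P x.
Proof.
move=> P1 Pa PM x; have [n] := ubnP (nu x); elim: n x => // n IH x.
rewrite ltnS => nux.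
case: (pselect (x = 1)) => [->//|x1].
case: (pselect (atoms M x)) => [/Pa//|xNa].
have [y [z [xE y1 z1]]] : exists y z, [/\ x = y * z, y <> 1 & z <> 1].
  apply: contrapT => no; apply: xNa; split=> // y z xE.
  case: (pselect (y = 1)) => [|y1]; [by left|right].
  by apply: contrapT => z1; apply: no; exists y, z.
have := leq_trans (nuM y z) (eq_leq (congr1 nu (esym xE))) => le.
rewrite xE; apply: PM; apply: IH; apply: leq_trans nux.
  by apply: leq_trans le; rewrite -[ltnLHS]addn0 ltn_add2l nu_gt0.
by apply: leq_trans le; rewrite -[ltnLHS]add0n ltn_add2r nu_gt0.
Qed.

(** * Quasi-central and fundamental elements *)

Definition absorbs_left D := forall x, exists y, x * D = D * y.
Definition absorbs_right D := forall x, exists y, D * x = y * D.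
Definition normal D := absorbs_left D /\ absorbs_right D.
Definition atoms_divide D := forall a, atoms M a -> ldivides a D.

(** The permutation of the atoms extends letter by letter to the monoid.
    Conversely, by cancellation, xD = D f(x) defines an automorphism f, and
    automorphisms permute the atoms. *)
Lemma quasi_centralP D : quasi_central M D <-> normal D.
Proof.
split=> [[s [[sA _ ssurj] sD]]|[DL DR]].
  split; apply: atom_ind.
  - by exists 1; rewrite mul1g mulg1.
  - by move=> a aA; exists (s a); exact: sD.
  - move=> x y [x' xE] [y' yE]; exists (x' * y').
    by rewrite -mulgA yE !mulgA xE.
  - by exists 1; rewrite mul1g mulg1.
  - by move=> b /ssurj [a aA <-]; exists a; rewrite sD.
  - move=> x y [x' xE] [y' yE]; exists (x' * y').
    by rewrite mulgA xE -!mulgA yE.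
have [f fD] := choice DL.
have f_eq1 x : f x = 1 -> x = 1.
  by move=> fx1; apply: (@rcancel1 D); rewrite fD fx1 mulg1.
have fM x y : f (x * y) = f x * f y.
  by apply: (@lcancel D); rewrite -fD -mulgA fD !mulgA fD.
have f_atom a : atoms M a <-> atoms M (f a).
  split=> [[a1 aA]|[fa1 faA]]; split=> [|y z E].
  - by move=> /f_eq1.
  - have [y' yE] := DR y; have [z' zE] := DR z.
    have aE : a = y' * z'.
      by apply: (@rcancel D); rewrite fD E mulgA yE -!mulgA zE.
    have [e|e] := aA _ _ aE; [left|right]; apply: (@lcancel1 D).
      by rewrite yE e mul1g.
    by rewrite zE e mul1g.
  - by move=> a1; apply: fa1; apply: (@lcancel1 D); rewrite -fD a1 mul1g.
  - by have [] := faA (f y) (f z); rewrite -?fM -?E // => /f_eq1; [left|right].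
exists f; split=> //; split=> [a /f_atom//|a b _ _ E|b bA].
  by apply: (@rcancel D); rewrite !fD E.
have [a aE] := DR b; have {aE} bE : b = f a.
  by apply: (@lcancel D); rewrite aE fD.
by exists a => //; apply/f_atom; rewrite -bE.
Qed.

(** If aD = D s(a) and D = aD', then aD = aD' s(a), so D = D' s(a): the second
    factorization required of a fundamental element comes for free. *)
Lemma fundamentalP D : fundamental M D <-> normal D /\ atoms_divide D.
Proof.
split=> [[s [sbij sD]]|[/quasi_centralP[s [sbij sD]] Ddiv]].
  split.
    apply/quasi_centralP; exists s; split=> // a aA.
    by have [Da [DE DE']] := sD a aA; rewrite {1}DE' mulgA -DE.
  by move=> a aA; have [Da [DE _]] := sD a aA; exists Da.
exists s; split=> // a aA; have [Da DE] := Ddiv a aA; exists Da; split=> //.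
by apply: (@lcancel a); rewrite (sD _ aA) {1}DE mulgA.
Qed.

Lemma normalM D E : normal D -> normal E -> normal (D * E).
Proof.
move=> [DL DR] [EL ER]; split=> x.
  have [y yE] := DL x; have [z zE] := EL y.
  by exists z; rewrite mulgA yE -!mulgA zE.
have [y yE] := ER x; have [z zE] := DR y.
by exists z; rewrite -mulgA yE !mulgA zE.
Qed.

Lemma normal_quotient D w : normal D -> normal (D * w) -> normal w.
Proof.
move=> [DL DR] [DwL DwR]; split=> x.
  have [y yE] := DR x; have [z zE] := DwL y; exists z.
  by apply: (@lcancel D); rewrite mulgA yE -mulgA zE mulgA.
have [y yE] := DwR x; have [z zE] := DL y; exists z.
by apply: (@lcancel D); rewrite !mulgA yE -zE mulgA.
Qed.

(** * The least element absorbing on the left and divisible by all atoms *)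

Hypothesis lcmM : lcm_condition M.

(** A common left divisor g of largest norm works: the right lcm of g with any
    other common left divisor is again one, so it equals g. *)
Lemma left_gcd u v : exists2 g, ldivides g u /\ ldivides g v &
  forall d, ldivides d u -> ldivides d v -> ldivides d g.
Proof.
pose common d := ldivides d u /\ ldivides d v.
pose P n := `[< exists2 d, common d & nu d = n >].
have exP : exists n, P n.
  exists (nu 1); apply/asboolP; exists 1 => //.
  by split; [exists u|exists v]; rewrite mul1g.
have boundP n : P n -> (n <= nu u)%N.
  move=> /asboolP[d [[w ->] _] <-].
  exact: leq_trans (leq_addr _ _) (nuM _ _).
case: (ex_maxnP exP boundP) => _ /asboolP[g [gu gv] <-] gmax.
exists g => // d du dv.
have [m [[w mE] dm mmin]] := (lcmM g d).1.
have : (nu m <= nu g)%N.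
  by apply: gmax; apply/asboolP; exists m => //; split; exact: mmin.
by rewrite mE => /nu_dvd_eq w1; move: dm; rewrite mE w1 mulg1.
Qed.

(** As G divides xD and xE, it suffices that the gcd of xD and xE divides xG.
    Here only the right lcm of x and G matters: it divides xD and xE, and
    writing it as xw, w divides D and E, hence G. *)
Lemma absorbs_left_gcd D E G : absorbs_left D -> absorbs_left E ->
  ldivides G D -> ldivides G E ->
  (forall d, ldivides d D -> ldivides d E -> ldivides d G) ->
  absorbs_left G.
Proof.
move=> DL EL [D' DE] [E' EE] Gmax x.
have [m [[w mE] Gm mmin]] := (lcmM x G).1.
have mdvd F F' : absorbs_left F -> F = G * F' -> ldivides w F.
  move=> FL FE; have [y yE] := FL x.
  have [|w' w'E] := mmin (x * F) (ex_intro _ F erefl).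
    by exists (F' * y); rewrite yE FE mulgA.
  by exists w'; apply: (@lcancel x); rewrite w'E mE mulgA.
have [t GE] : ldivides w G by apply: Gmax; [exact: mdvd DE|exact: mdvd EE].
have [q qE] := Gm.
by exists (q * t); rewrite {1}GE mulgA -mE qE mulgA.
Qed.

(** The characterization of fundamental elements with MG = GM weakened to an
    inclusion, so that left gcds inherit it. *)
Definition absorbing_full G := absorbs_left G /\ atoms_divide G.

(** The left gcd of an element of least norm with any other element cannot have
    smaller norm, hence is the former. *)
Lemma least_absorbing_full D : absorbing_full D ->
  exists2 G, absorbing_full G & forall E, absorbing_full E -> ldivides G E.
Proof.
move=> Dfull; pose P n := `[< exists2 G, absorbing_full G & nu G = n >].
have exP : exists n, P n by exists (nu D); apply/asboolP; exists D.
case: (ex_minnP exP) => _ /asboolP[G Gfull <-] Gmin.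
exists G => // E [EL Ediv]; have [H [HG HE] Hmax] := left_gcd G E.
have Hfull : absorbing_full H.
  split=> [|a aA]; first by apply: (@absorbs_left_gcd G E) => //; case: Gfull.
  by apply: Hmax; [apply: Gfull.2|exact: Ediv].
have [w GE] := HG.
have := Gmin (nu H) (asboolT (ex_intro2 _ _ H Hfull erefl)).
by rewrite GE => /nu_dvd_eq ->; rewrite mulg1.
Qed.

(** Conjugation by D is an automorphism, so it fixes an element characterized
    by minimality.  P and Q are the images of G under this automorphism and its
    inverse; G divides Q, so P divides G, while G divides P. *)
Lemma least_absorbing_full_commute D G : normal D ->
  absorbing_full G -> (forall E, absorbing_full E -> ldivides G E) ->
  G * D = D * G.
Proof.
move=> Dnormal [GL Gdiv] Gmin; have [DL DR] := Dnormal.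
have [s [[sA _ ssurj] sD]] := (quasi_centralP D).2 Dnormal.
have [P PE] := DL G; have [Q QE] := DR G.
have Pfull : absorbing_full P.
  split=> [x|_ /ssurj[a aA <-]].
    have [y yE] := DR x; have [z zE] := GL y; have [t tE] := DL z.
    exists t; apply: (@lcancel D).
    by rewrite mulgA yE -mulgA -PE mulgA zE -mulgA tE !mulgA PE.
  have [G' GE] := Gdiv a aA; have [t tE] := DL G'.
  exists t; apply: (@lcancel D).
  by rewrite -PE {1}GE -mulgA tE !mulgA sD.
have Qfull : absorbing_full Q.
  split=> [x|a aA].
    have [y yE] := DL x; have [z zE] := GL y; have [t tE] := DR z.
    exists t; apply: (@rcancel D).
    by rewrite -mulgA -QE mulgA yE -mulgA zE mulgA QE -!mulgA tE.
  have [G' GE] := Gdiv (s a) (sA a aA); have [t tE] := DR G'.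
  exists t; apply: (@rcancel D).
  by rewrite -QE {1}GE mulgA -sD // -!mulgA tE.
have PG : ldivides P G.
  have [v vE] := Gmin Q Qfull; have [t tE] := DL v.
  exists t; apply: (@lcancel D).
  by rewrite QE vE -mulgA tE !mulgA PE.
by rewrite PE (ldivides_anti PG (Gmin P Pfull)).
Qed.

Hypothesis finite_divisors : forall D, finite_set [set x | ldivides x D].

(** The injective endomorphism f given by xG = G f(x) fixes D, so it stabilizes
    the finite set of left divisors of D; being onto there, it reaches all
    atoms. *)
Lemma absorbs_left_normal D G : atoms_divide D -> absorbs_left G ->
  G * D = D * G -> normal G.
Proof.
move=> Ddiv GL GD; split=> //.
have [f fG] := choice GL.
have f_inj : injective f.
  by move=> x y E; apply: (@rcancel G); rewrite !fG E.
have f_div x : ldivides x D -> ldivides (f x) D.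
  move=> [y DE]; exists (f y); apply: (@lcancel G).
  by rewrite GD {1}DE -mulgA fG mulgA fG mulgA.
apply: atom_ind => [|b /Ddiv bD|x y [x' xE] [y' yE]].
- by exists 1; rewrite mul1g mulg1.
- have [a _ <-] := finite_inj_surj (finite_divisors D) f_div f_inj bD.
  by exists a; rewrite fG.
- by exists (x' * y'); rewrite mulgA xE -!mulgA yE.
Qed.

(** * A generator of the fundamental elements *)

Lemma least_fundamental : fundamental M !=set0 ->
  exists2 G, fundamental M G & forall E, fundamental M E -> ldivides G E.
Proof.
move=> [D /fundamentalP[Dnormal Ddiv]].
have [G Gfull Gmin] := least_absorbing_full (conj Dnormal.1 Ddiv).
exists G.
  apply/fundamentalP; split; last exact: Gfull.2.
  apply: (absorbs_left_normal Ddiv Gfull.1).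
  exact: least_absorbing_full_commute.
by move=> E /fundamentalP[[EL _] Ediv]; apply: Gmin.
Qed.

(** Fundamental elements are even of the form Dw with w quasi-central, so the
    left factor can be taken to be 1. *)
Lemma fundamental_least D :
  fundamental M D -> (forall E, fundamental M E -> ldivides D E) ->
  fundamental M =
    [set x * D * y | x in quasi_central M & y in quasi_central M].
Proof.
move=> /fundamentalP[Dnormal Ddiv] Dmin; apply/seteqP; split=> [E EF|].
  have [w EE] := Dmin E EF; have [Enormal _] := (fundamentalP E).1 EF.
  exists 1; first by apply/quasi_centralP; split=> x; exists x;
    rewrite mul1g mulg1.
  exists w; last by rewrite mul1g EE.
  by apply/quasi_centralP; apply: (@normal_quotient D) => //; rewrite -EE.
move=> _ [x /quasi_centralP xn [y /quasi_centralP yn <-]].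
apply/fundamentalP; split; first by do !apply: normalM.
move=> a /Ddiv [D' DE]; have [z zE] := Dnormal.1 x.
by exists (D' * z * y); rewrite zE {1}DE !mulgA.
Qed.

End GarsideMonoid.

(** * Finitely many divisors *)

Section FiniteDivisors.
Variables (L : finType) (R : seq (seq L * seq L)) (nu : pmonoid R -> nat).
Hypothesis nu_eq0 : forall x, nu x = 0%N <-> x = 1.
Hypothesis nuM : forall x y, (nu x + nu y <= nu (x * y)%g)%N.

(** Some generators may represent 1; removing them from a word representing x
    leaves letters of norm at least 1, and norms are superadditive. *)
Lemma short_word (x : pmonoid R) :
  exists2 w : seq L, pword R w = x & (size w <= nu x)%N.
Proof.
rewrite -(pword_repr x).
elim: (repr x) => [|g w [v vE vle]]; first by exists [::].
rewrite -cat1s pwordM; case: (pselect (pword R [:: g] = 1)) => [->|g1].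
  by exists v; rewrite mul1g.
exists (g :: v); first by rewrite -cat1s pwordM vE.
apply: leq_trans (nuM _ _); rewrite -[size _]add1n leq_add //.
by rewrite lt0n; apply/eqP => /nu_eq0.
Qed.

Lemma finite_divisors (D : pmonoid R) : finite_set [set x | ldivides x D].
Proof.
apply: (@sub_finite_set _ _
  [set pword R w | w in [set: (nu D).-bseq L]]).
  move=> x [y DE]; have [w wE wle] := short_word x.
  have wD : (size w <= nu D)%N.
    by rewrite DE; apply: leq_trans (nuM x y); apply: leq_trans (leq_addr _ _).
  by exists (Bseq wD).
exact/finite_image/finite_finset.
Qed.

End FiniteDivisors.

Theorem proposition2p5 (L : finType) (R : seq (seq L * seq L))
    (hatomic : atomic (pmonoid R))
    (hcancel : cancellative (pmonoid R))
    (hlcm : lcm_condition (pmonoid R))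
    (hfund : fundamental (pmonoid R) !=set0) :
  exists D : pmonoid R,
    fundamental (pmonoid R) D /\
    fundamental (pmonoid R) =
      [set x * D * y | x in quasi_central (pmonoid R)
                     & y in quasi_central (pmonoid R)].
Proof.
have [nu [nu_eq0 nuM]] := hatomic.
have finD := finite_divisors nu_eq0 nuM.
have [D DF Dmin] := least_fundamental nu_eq0 nuM hcancel hlcm finD hfund.
by exists D; split=> //; apply: (fundamental_least nu_eq0 nuM).
Qed.
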